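(* For every fixed integer $d\geq 1$, every even positive integer $n$, and every integer $0\leq k\leq n$, \[ 2\,\mathbb{E}X_k(\widehat G_{n,d})\leq \mathbb{E}\operatorname{MaxBis}(\widehat G_{2n,d})+7\sqrt{dn\log(1+dn)} . \]
   Context: For a finite undirected multigraph $G$ on $V$ (loops and multiple edges allowed) and $S\subseteq V$, $\operatorname{cut}_G(S)$ is the number of edges with exactly one endpoint in $S$ (multiple edges counted with multiplicity; loops contribute nothing). Define \[ X_k(G)=\max_{S\subseteq V,\ |S|=k}\operatorname{cut}_G(S),\qquad \operatorname{MaxBis}(G)=\max_{S\subseteq V,\ |S|=\lfloor |V|/2\rfloor}\operatorname{cut}_G(S). \] For an integer $N$ with $dN$ even, $\widehat G_{N,d}$ denotes the $d$-regular configuration model on $[N]=\{1,\dots,N\}$: attach $d$ labeled half-edges to each vertex, choose a uniformly random perfect matching of all $dN$ half-edges, and let each matched pair of half-edges give an edge between the two vertices to which they are attached (a loop if these coincide). *)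

(* Defs.v *)
From HB Require Import structures.
From mathcomp Require Import all_boot all_order all_algebra.
From mathcomp Require Import reals exp.

Set Implicit Arguments.
Unset Strict Implicit.
Unset Printing Implicit Defensive.

Import Order.TTheory GRing.Theory Num.Theory.

(* Edges form a type of their own, so parallel edges are distinct elements;
   a loop is an edge whose endpoint set is a singleton. *)
Record multigraph (V : finType) := Multigraph {
  edge : finType;
  ends : edge -> {set V};
  card_ends : forall e, 0 < #|ends e| <= 2 }.

Definition cut (V : finType) (G : multigraph V) (S : {set V}) : nat :=
  #|[set e : edge G | (#|ends e| == 2) && (#|ends e :&: S| == 1)]|.

(* A maximum over an empty family is 0; this only matters when k > #|V|. *)
Definition maxcut_card (V : finType) (k : nat) (G : multigraph V) : nat :=
  \max_(S : {set V} | #|S| == k) cut G S.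

Definition maxbis (V : finType) (G : multigraph V) : nat :=
  \max_(S : {set V} | #|S| == #|V|./2) cut G S.

Definition is_perfect_matching (H : finType) (M : {set {set H}}) : bool :=
  partition M [set: H] && [forall B in M, #|B| == 2].

Definition perfect_matching (H : finType) : finType :=
  {M : {set {set H}} | is_perfect_matching M}.

(* (v, i) is the i-th half-edge attached to the vertex v. *)
Definition half_edge (N d : nat) : finType := ('I_N * 'I_d)%type.

Definition config_edge (N d : nat) (M : perfect_matching (half_edge N d))
  : finType := {B : {set half_edge N d} | B \in val M}.

Definition config_ends (N d : nat) (M : perfect_matching (half_edge N d))
  (e : config_edge M) : {set 'I_N} := [set h.1 | h in val e].

Lemma card_config_ends (N d : nat) (M : perfect_matching (half_edge N d))
  (e : config_edge M) : 0 < #|config_ends e| <= 2.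
Proof.
have /andP[_ /'forall_implyP/(_ _ (valP e))/eqP cardB] := valP M.
apply/andP; split; last by rewrite -cardB leq_imset_card.
by rewrite card_gt0 imset_eq0 -card_gt0 cardB.
Qed.

Definition config_graph (N d : nat) (M : perfect_matching (half_edge N d))
  : multigraph 'I_N := Multigraph (@card_config_ends N d M).

Local Open Scope ring_scope.

(* Expectation of f under the configuration model, i.e. the average of f over
   all perfect matchings of the half-edges. There is one only if d * N is even;
   otherwise the value is 0 / 0 = 0. *)
Definition config_expect (R : realType) (N d : nat)
  (f : multigraph 'I_N -> R) : R :=
  (\sum_(M : perfect_matching (half_edge N d)) f (config_graph M))
    / #|perfect_matching (half_edge N d)|%:R.

(* Main.v *)
Require Import Defs.
From HB Require Import structures.
From mathcomp Require Import all_boot all_order all_algebra all_fingroup.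
From mathcomp Require Import reals exp ring lra zify.

Set Implicit Arguments.
Unset Strict Implicit.
Unset Printing Implicit Defensive.

(* Two independent copies of the model on n vertices, with a k-subset on one
   side and the complement of a k-subset on the other, give a bisection; this
   bounds 2 E X_k by the expected maximal bisection over pure matchings, i.e.
   those without an edge between the two halves of the 2n vertices.

   To pass to a uniform matching, fix its cross pairs and average over all
   permutations of half-edges that preserve the half. Replacing a cross pair by
   a pair inside a random half does not increase the average cut, up to an
   error of order 1/a + 1/b, where a and b are the numbers of unused half-edges
   in the two halves: two half-edges fail to increase the maximum exactly when
   all optimal cuts treat them alike, and the collision probability of two
   distributions is at most the mean of their self-collision probabilities.
   Under these replacements (a, b) performs a walk, which is kept above w/2 by
   deleting cross pairs when a or b is too small. With w = sqrt (2dn) a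
   quadratic potential shows that the total loss is at most 4w. *)

Import Order.TTheory GRing.Theory Num.Theory.
Local Open Scope ring_scope.

(** * Maximum cuts of lists of pairs *)

Section MaxCut.
Local Open Scope nat_scope.
Variables (I H : finType) (ok : pred I) (chi : I -> H -> bool).
Implicit Types (i : I) (x y : H) (p : H * H) (P : seq (H * H)).

Definition separates i p := chi i p.1 != chi i p.2.

(** In the application [i] is a vertex set, [ok] fixes its size and [chi i h] tells whether the
    vertex of the half-edge [h] lies in it. The list may leave half-edges unmatched, so pairs can be
    added and removed one at a time. *)
Definition mcut P := \max_(i | ok i) count (separates i) P.

Lemma mcut_geP i P : ok i -> count (separates i) P <= mcut P.
Proof. by move=> oki; apply: (bigop.bigmax_sup i). Qed.

Lemma eq_mcut P Q : (forall i, count (separates i) P = count (separates i) Q) ->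
  mcut P = mcut Q.
Proof. by move=> ePQ; apply: eq_bigr => i _. Qed.

Lemma mcut_perm P Q : perm_eq P Q -> mcut P = mcut Q.
Proof. by move=> /seq.permP ePQ; apply: eq_mcut => i. Qed.

Lemma mcut_swap x y P : mcut ((x, y) :: P) = mcut ((y, x) :: P).
Proof. by apply: eq_mcut => i /=; rewrite /separates eq_sym. Qed.

(** The signature of [x]: the optimal cuts that have [x] on their [true] side. *)
Definition optima_at P x : {set I} :=
  [set i | [&& ok i, count (separates i) P == mcut P & chi i x]].

(* Adding a pair raises the maximum exactly when some optimal cut of [P]
   separates it, and not being separated by any optimal cut is equality of
   signatures, hence an equivalence relation. *)
Lemma mcut_cons x y P : (exists i, ok i) ->
  mcut ((x, y) :: P) = mcut P + (optima_at P x != optima_at P y).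
Proof.
case=> i0 oki0; apply/eqP; rewrite eqn_leq; apply/andP; split.
  apply/bigop.bigmax_leqP => i oki /=; rewrite addnC.
  have lei := mcut_geP P oki.
  have [ei|ni] := eqVneq (count (separates i) P) (mcut P); last first.
    have : count (separates i) P < mcut P by rewrite ltn_neqAle ni.
    by case: (separates _ _); case: (_ != _) => /=; lia.
  case: eqP => [/setP/(_ i)|_] /=; last by case: (separates _ _); lia.
  by rewrite !inE oki ei eqxx /separates /= => ->; rewrite eqxx; lia.
have [i oki ei] : exists2 i, ok i & mcut P = count (separates i) P.
  have card_ok : 0 < #|ok| by apply/card_gt0P; exists i0.
  have [i oki ei] := bigop.eq_bigmax_cond (fun i => count (separates i) P) card_ok.
  by exists i.
case: eqP => [_|ne] /=.
  rewrite addn0 {1}ei; apply: leq_trans (mcut_geP _ oki).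
  by rewrite /= leq_addl.
have [j] : exists j, (j \in optima_at P x) != (j \in optima_at P y).
  apply/existsP; apply: contra_notT ne; rewrite negb_exists => /forallP eqj.
  by apply/setP => j; have := eqj j; rewrite negbK => /eqP.
rewrite !inE; case okj: (ok j); last by rewrite eqxx.
case ej: (count _ _ == _); last by rewrite eqxx.
move/eqP: ej => ej /= sepj.
by apply: leq_trans (mcut_geP _ okj); rewrite /= /separates sepj ej addnC.
Qed.

Lemma mcut_cons_ge p P : (exists i, ok i) -> mcut P <= mcut (p :: P).
Proof. by case: p => x y /mcut_cons ->; apply: leq_addr. Qed.

Lemma mcut_cons_le p P : (exists i, ok i) -> mcut (p :: P) <= (mcut P).+1.
Proof. by case: p => x y /mcut_cons ->; rewrite -addn1 leq_add2l leq_b1. Qed.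

End MaxCut.

(* Cauchy-Schwarz for the class sizes of an equivalence relation, followed by
   AM-GM. *)
Lemma collision_le (R : realFieldType) (H : finType) (K : finType)
  (key : H -> K) (U V : {set H}) :
  2 * (#|U|%:R * #|V|%:R) * (\sum_(u in U) \sum_(v in V) (key u == key v)%:R)
  <= #|V|%:R ^+ 2 * (\sum_(u in U) \sum_(v in U) (key u == key v)%:R)
   + #|U|%:R ^+ 2 * (\sum_(u in V) \sum_(v in V) (key u == key v)%:R) :> R.
Proof.
pose c (W : {set H}) k : R := \sum_(u in W) (key u == k)%:R.
have cE (W Z : {set H}) :
    \sum_(u in W) \sum_(v in Z) (key u == key v)%:R = \sum_k c W k * c Z k :> R.
  under [RHS]eq_bigr => k _ do rewrite /c mulr_suml.
  rewrite [RHS]exchange_big; apply: eq_bigr => u _ /=.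
  rewrite [RHS](bigD1 (key u)) //= eqxx mul1r [X in _ + X]big1 ?addr0.
by rewrite /c; apply: eq_bigr => v _; rewrite eq_sym.
  by move=> k /negbTE nk; rewrite eq_sym nk mul0r.
rewrite !cE !mulr_sumr -big_split /=; apply: ler_sum => k _.
rewrite -subr_ge0; apply: le_trans (sqr_ge0 (#|V|%:R * c U k - #|U|%:R * c V k)) _.
by rewrite le_eqVlt; apply/orP; left; apply/eqP; ring.
Qed.

(** * Lists of pairs and their endpoints *)

Definition map_pairs (T U : Type) (f : T -> U) (P : seq (T * T)) :=
  [seq (f p.1, f p.2) | p <- P].

(** That the pairs are disjoint and nondegenerate becomes [uniq]; that they also cover everything
    becomes [perm_eq] with the enumeration. *)
Definition endpoints (T : Type) (P : seq (T * T)) : seq T :=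
  flatten [seq [:: p.1; p.2] | p <- P].

Section Endpoints.
Local Open Scope nat_scope.
Variables (T U V : Type).
Implicit Types (P Q : seq (T * T)).

Lemma endpoints_cat P Q : endpoints (P ++ Q) = endpoints P ++ endpoints Q.
Proof. by rewrite /endpoints map_cat flatten_cat. Qed.

Lemma endpoints_map (f : T -> U) P :
  endpoints (map_pairs f P) = map f (endpoints P).
Proof. by elim: P => //= p P; rewrite /endpoints /= => ->. Qed.

Lemma map_pairs_comp (f : T -> U) (g : U -> V) P :
  map_pairs g (map_pairs f P) = map_pairs (g \o f) P.
Proof. by rewrite /map_pairs -map_comp. Qed.

Lemma size_endpoints P : size (endpoints P) = 2 * size P.
Proof. by elim: P => //= p P IH; rewrite /endpoints /= -/(endpoints P) IH; lia. Qed.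

Lemma endpoints_inj P Q : endpoints P = endpoints Q -> P = Q.
Proof.
elim: P Q => [|[x y] P IH] [|[x' y'] Q] //= [-> -> /IH ->] //.
Qed.

End Endpoints.

Lemma perm_endpoints (T : eqType) (P Q : seq (T * T)) :
  perm_eq P Q -> perm_eq (endpoints P) (endpoints Q).
Proof.
by move=> ePQ; apply: perm_flatten; apply: perm_map.
Qed.

(** * Permutations preserving a two-valued type *)

Section TypePerms.
Variables (H : finType) (ty : pred H).

Definition type_perms : {set {perm H}} 
  := [set g : {perm H} | [forall h, ty (g h) == ty h]].

Lemma type_permsP (g : {perm H}) : reflect (forall h, ty (g h) = ty h) (g \in type_perms).
Proof. by rewrite inE; apply: (iffP forallP) => e h; apply/eqP. Qed.

Lemma type_perms1 : (1%g : {perm H}) \in type_perms.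
Proof. by apply/type_permsP => h; rewrite perm1. Qed.

Lemma type_permsMl (g h : {perm H}) : g \in type_perms ->
  ((g * h)%g \in type_perms) = (h \in type_perms).
Proof.
move=> /type_permsP gP; apply/type_permsP/type_permsP => hP x.
  by rewrite -[x](permKV g) -permM hP -gP permKV.
by rewrite permM hP gP.
Qed.

(** Each list is completed to an enumeration of [H] by the missing elements of type [true], then
    those of type [false]. Equal types along [s] and [t] leave equally many missing elements, so
    matching the two enumerations position by position preserves types. *)
Lemma type_perm_extend (s t : seq H) : uniq s -> uniq t ->
  map ty s = map ty t -> exists2 g, g \in type_perms & map g s = t.
Proof.
pose rest (r : seq H) b := [seq h <- enum H | (h \notin r) && (ty h == b)].
pose full r := r ++ (rest r true ++ rest r false).
have mem_rest r b h : (h \in rest r b) = (h \notin r) && (ty h == b).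
  by rewrite mem_filter mem_enum andbT.
have uniq_full r : uniq r -> uniq (full r).
  move=> ur; rewrite !cat_uniq ur !(filter_uniq _ (enum_uniq _)) andbT /=.
  apply/andP; split; apply/hasPn => h; rewrite ?mem_cat !mem_rest.
    by case/orP=> /andP[].
  by case/andP => _ /eqP ->; rewrite andbF.
have mem_full r h : h \in full r.
  rewrite !mem_cat !mem_rest.
  by case: (h \in r) => //; case: (ty h).
have count_rest r b : uniq r ->
    (size (rest r b) + count (fun h => ty h == b) r
      = count (fun h => ty h == b) (enum H))%N.
  move=> ur; rewrite size_filter addnC.
  have /seq.permP/(_ (fun h => ty h == b)) : perm_eq (r ++ [seq h <- enum H | h \notin r]) (enum H).
    apply: uniq_perm; rewrite ?enum_uniq //.
      rewrite cat_uniq ur filter_uniq ?enum_uniq // andbT.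
      by apply/hasPn => h; rewrite mem_filter => /andP[].
    by move=> h; rewrite mem_cat mem_filter mem_enum inE andbT orbN.
  rewrite count_cat => <-; congr addn.
  by rewrite count_filter; apply: eq_count => h; rewrite /= andbC.
have ty_rest r b : map ty (rest r b) = nseq (size (rest r b)) b.
  rewrite -(size_map ty); apply/all_pred1P; rewrite all_map.
  by apply/allP => h; rewrite mem_filter => /andP[/andP[]].
move=> us ut est.
have est_rest b : size (rest s b) = size (rest t b).
  apply/eqP; rewrite -(eqn_add2r (count (fun h => ty h == b) s)) count_rest //.
  rewrite -(count_rest t) //; apply/eqP; congr addn.
  by rewrite -!(count_map ty (pred1 b)) est.
have est_full : map ty (full s) = map ty (full t).
  by rewrite !map_cat !ty_rest !est_rest est.
have size_full : size (full s) = size (full t) by rewrite -(size_map ty) est_full size_map.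
pose f h := nth h (full t) (index h (full s)).
have f_inj : injective f.
  move=> x y; rewrite /f (set_nth_default x y) -?size_full ?index_mem //.
  move/eqP; rewrite nth_uniq -?size_full ?index_mem ?uniq_full //.
  by move/eqP/index_inj; apply.
exists (perm f_inj).
  apply/type_permsP => h; rewrite permE /f.
  rewrite -(nth_map h (ty h)) -?size_full ?index_mem //.
  by rewrite -est_full (nth_map h) ?index_mem // nth_index.
have size_st : size s = size t by rewrite -(size_map ty) est size_map.
have /eqP: map (perm f_inj) (full s) = full t.
  have [x0 _|H0] := pickP H; last by case: (full s) (full t) size_full => [|x] [|y] //; have := H0 x.
  apply: (@eq_from_nth _ x0) => [|i]; rewrite size_map // => lti.
  rewrite (nth_map x0) // permE /f index_uniq ?uniq_full //.
  by apply: set_nth_default; rewrite -size_full.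
by rewrite map_cat eqseq_cat ?size_map // => /andP[/eqP].
Qed.
End TypePerms.

(** * Averaging the maximum cut over type-preserving permutations *)

Section AverageCut.
Variables (R : realFieldType) (I H : finType).
Variables (ok : pred I) (chi : I -> H -> bool) (ty : pred H).
Hypothesis ok_ex : exists i, ok i.
Implicit Types (x y u v : H) (P Q : seq (H * H)).

Local Notation G := (type_perms ty).

(** The expected maximum cut after a uniform relabelling of the elements within each type. *)
Definition avgcut P : R :=
  (\sum_(g in G) (mcut ok chi (map_pairs g P))%:R) / #|G|%:R.

Lemma card_type_perms_gt0 : 0 < #|G|%:R :> R.
Proof. by rewrite ltr0n; apply/card_gt0P; exists 1%g; apply: type_perms1. Qed.

Lemma le_avgcut P Q c :
  (forall g, g \in G -> (mcut ok chi (map_pairs g P))%:R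
                         <= (mcut ok chi (map_pairs g Q))%:R + c) ->
  avgcut P <= avgcut Q + c.
Proof.
move=> lePQ; rewrite /avgcut ler_pdivrMr ?card_type_perms_gt0 //.
rewrite mulrDl divfK ?gt_eqF ?card_type_perms_gt0 //.
apply: le_trans (ler_sum _ lePQ) _.
by rewrite big_split /= sumr_const mulr_natr.
Qed.

Lemma avgcut_perm P Q : perm_eq P Q -> avgcut P = avgcut Q.
Proof.
move=> ePQ; congr (_ / _); apply: eq_bigr => g _; congr _%:R.
by apply: mcut_perm; apply: perm_map.
Qed.

Lemma avgcut_swap x y P : avgcut ((x, y) :: P) = avgcut ((y, x) :: P).
Proof. by congr (_ / _); apply: eq_bigr => g _; congr _%:R; apply: mcut_swap. Qed.

Lemma avgcut_act g P : g \in G -> avgcut (map_pairs g P) = avgcut P.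
Proof.
move=> Gg; congr (_ / _); rewrite [RHS](reindex_inj (mulgI g)) /=.
apply: eq_big => [h|h _]; first by rewrite type_permsMl.
congr _%:R; congr mcut; rewrite map_pairs_comp.
by apply: eq_map => p /=; rewrite !permM.
Qed.

(** Some type-preserving permutation carries [P] to [Q], and the average is invariant under it; so
    only the types along the list matter. *)
Lemma avgcut_endpoints P Q : uniq (endpoints P) -> uniq (endpoints Q) ->
  map ty (endpoints P) = map ty (endpoints Q) -> avgcut P = avgcut Q.
Proof.
move=> uP uQ /(type_perm_extend uP uQ)[g Gg].
by rewrite -endpoints_map => /endpoints_inj <-; rewrite avgcut_act.
Qed.

Lemma avgcut_cons_ge p P : avgcut P <= avgcut (p :: P).
Proof.
rewrite -[leRHS]addr0; apply: le_avgcut => g _.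
by rewrite addr0 ler_nat; apply: mcut_cons_ge.
Qed.

Lemma avgcut_cons_le p P : avgcut (p :: P) <= avgcut P + 1.
Proof.
by apply: le_avgcut => g _; rewrite natr1 ler_nat; apply: mcut_cons_le.
Qed.

Definition unused (b : bool) P : {set H} :=
  [set x | (ty x == b) && (x \notin endpoints P)].

Lemma unused_neq P u v : u \in unused true P -> v \in unused false P -> u != v.
Proof.
by rewrite !inE => /andP[tu _] /andP[tv _]; apply: contraTneq tu => ->; rewrite (eqP tv).
Qed.

(** Divided by [#|U| * #|V|], this is the probability that random elements of [U] and [V] have equal
    signatures, that is, that pairing them fails to raise the maximum. *)
Definition avg_collisions P (U V : {set H}) : R :=
  (\sum_(g in G) \sum_(u in U) \sum_(v in V)
     (optima_at ok chi (map_pairs g P) (g u)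
        == optima_at ok chi (map_pairs g P) (g v))%:R) / #|G|%:R.

(** A pair adds 1 to the maximum unless its signatures collide, so the collisions are exactly what
    is missing from a gain of 1 for every pair. *)
Lemma sum_avgcut_cons P (U V : {set H}) :
  \sum_(u in U) \sum_(v in V) avgcut ((u, v) :: P)
    = #|U|%:R * #|V|%:R * (avgcut P + 1) - avg_collisions P U V.
Proof.
have consE u v : avgcut ((u, v) :: P) = avgcut P + 1 -
    (\sum_(g in G) (optima_at ok chi (map_pairs g P) (g u)
        == optima_at ok chi (map_pairs g P) (g v))%:R) / #|G|%:R.
  rewrite /avgcut /= -[X in _ + X - _](@divff _ #|G|%:R) ?gt_eqF ?card_type_perms_gt0 //.
  rewrite -mulrDl -mulrBl; congr (_ / _).
  rewrite -[#|G|%:R]sumr_const -big_split -sumrB /=; apply: eq_bigr => g _.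
  rewrite mcut_cons // natrD -addrA; congr (_ + _).
  by case: eqP => _; rewrite ?subrr ?subr0.
under eq_bigr => u _ do
  (under eq_bigr => v _ do rewrite consE; rewrite sumrB sumr_const -mulr_suml).
rewrite sumrB sumr_const -mulr_suml; congr (_ - _ / _).
  by rewrite -[LHS]mulr_natl -[X in _ * X]mulr_natl mulrA.
under eq_bigr => u _ do rewrite exchange_big.
by rewrite exchange_big.
Qed.

Lemma avg_collisions_le P (U V : {set H}) :
  2 * (#|U|%:R * #|V|%:R) * avg_collisions P U V
  <= #|V|%:R ^+ 2 * avg_collisions P U U + #|U|%:R ^+ 2 * avg_collisions P V V.
Proof.
rewrite !mulrA -mulrDl ler_pM2r ?invr_gt0 ?card_type_perms_gt0 //.
rewrite [leLHS]mulr_sumr [X in _ <= X + _]mulr_sumr [X in _ <= _ + X]mulr_sumr.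
rewrite -big_split; apply: ler_sum => g _ /=.
rewrite -(mulrA 2); exact: (collision_le _ (fun x => optima_at ok chi (map_pairs g P) (g x))).
Qed.

Lemma avgcut_cons_unused P b b' x y x' y' : uniq (endpoints P) ->
  x \in unused b P -> x' \in unused b P -> 
  y \in unused b' P -> y' \in unused b' P ->
  x != y -> x' != y' -> avgcut ((x, y) :: P) = avgcut ((x', y') :: P).
Proof.
rewrite !inE => uP /andP[/eqP tx nx] /andP[/eqP tx' nx'].
move=> /andP[/eqP t_y ny] /andP[/eqP ty' ny'] nxy nxy'.
apply: avgcut_endpoints; rewrite /endpoints /= -/(endpoints P).
- by rewrite !inE negb_or nxy nx ny.
- by rewrite !inE negb_or nxy' nx' ny'.
- by rewrite tx tx' t_y ty'.
Qed.

(* The sum over all ordered pairs includes the degenerate ones [(u, u)], which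
   never contribute to the cut; this is the source of the error [1 / #|U|]. *)
Lemma avgcut_pure_collisions P b u1 u2 : uniq (endpoints P) ->
  u1 \in unused b P -> u2 \in unused b P -> u1 != u2 ->
  avg_collisions P (unused b P) (unused b P)
    <= #|unused b P|%:R ^+ 2 * (avgcut P + 1 - avgcut ((u1, u2) :: P))
       + #|unused b P|%:R.
Proof.
move=> uP Uu1 Uu2 nu12; set U := unused b P; set D := avgcut (_ :: _).
set a : R := #|U|%:R.
have diag u : avgcut ((u, u) :: P) = avgcut P.
  by congr (_ / _); apply: eq_bigr => g _; rewrite /= mcut_cons // eqxx addn0.
have sumE : \sum_(u in U) \sum_(v in U) avgcut ((u, v) :: P)
    = a * avgcut P + a * (a - 1) * D.
  have rowE u : u \in U -> \sum_(v in U) avgcut ((u, v) :: P) = avgcut P + (a - 1) * D.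
    move=> Uu; rewrite (bigD1 u) //= diag; congr (_ + _).
    rewrite (eq_bigr (fun=> D)) => [|v /andP[Uv nuv]]; last first.
      by apply: (avgcut_cons_unused (b := b) (b' := b)); rewrite // eq_sym.
    rewrite sumr_const -mulr_natl; congr (_ * _).
    have -> : #|[pred v | v \in U & v != u]| = #|U :\ u|.
      by apply: eq_card => v; rewrite !inE andbC.
    by rewrite /a (cardsD1 u U) Uu natrD addrAC subrr add0r.
  by rewrite (eq_bigr _ rowE) sumr_const -[LHS]mulr_natl mulrDr mulrA.
have := sum_avgcut_cons P U U; rewrite sumE -/a => e.
have a_ge0 : 0 <= a by rewrite ler0n.
have leD : D <= avgcut P + 1 by apply: avgcut_cons_le.
(* With m for [avgcut P], solving [e] gives a ^ 2 * (m + 1 - D) + a * (D - m) collisions, and D - m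
   <= 1. *)
by nra.
Qed.

(** Divided by 2 * a ^ 2 * b ^ 2, the collision inequality bounds the failure probability of a cross
    pair by the mean of the self-collision probabilities of the two sides. Each of these exceeds the
    failure probability of a pair inside its side by at most 1 / a or 1 / b. *)
Lemma avgcut_cross P u1 u2 v1 v2 : uniq (endpoints P) ->
  u1 \in unused true P -> u2 \in unused true P -> u1 != u2 ->
  v1 \in unused false P -> v2 \in unused false P -> v1 != v2 ->
  (avgcut ((u1, u2) :: P) + avgcut ((v1, v2) :: P)) / 2
    - (#|unused true P|%:R ^-1 + #|unused false P|%:R ^-1) / 2
  <= avgcut ((u1, v1) :: P).
Proof.
move=> uP Uu1 Uu2 nu12 Vv1 Vv2 nv12.
set U := unused true P in Uu1 Uu2 *; set V := unused false P in Vv1 Vv2 *.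
have := avgcut_pure_collisions uP Uu1 Uu2 nu12.
have := avgcut_pure_collisions uP Vv1 Vv2 nv12.
have := avg_collisions_le P U V; rewrite -/U -/V /=.
set a : R := #|U|%:R; set b : R := #|V|%:R.
have a_gt0 : 0 < a by rewrite ltr0n; apply/card_gt0P; exists u1.
have b_gt0 : 0 < b by rewrite ltr0n; apply/card_gt0P; exists v1.
set C := avgcut ((u1, v1) :: P).
have sumE : \sum_(u in U) \sum_(v in V) avgcut ((u, v) :: P) = a * b * C.
  rewrite (eq_bigr (fun=> b * C)) => [|u Uu].
    by rewrite sumr_const -[LHS]mulr_natl mulrA.
  rewrite (eq_bigr (fun=> C)) => [|v Vv]; first by rewrite sumr_const -mulr_natl.
  apply: (avgcut_cons_unused (b := true) (b' := false)) => //.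
    exact: unused_neq Uu Vv.
  exact: unused_neq Uu1 Vv1.
have := sum_avgcut_cons P U V; rewrite sumE -/a -/b.
set D := avgcut ((u1, u2) :: P); set D' := avgcut ((v1, v2) :: P).
move: (avg_collisions P U V) (avg_collisions P U U) (avg_collisions P V V) => X Y Z.
move: (avgcut P) => m eX leX leZ leY.
have a0 : a != 0 by rewrite gt_eqF.
have b0 : b != 0 by rewrite gt_eqF.
have {eX}eX : X = a * b * (m + 1 - C) by rewrite mulrBr eX; ring.
have : 2 * (a * b) * (a * b * (m + 1 - C))
    <= b ^+ 2 * (a ^+ 2 * (m + 1 - D) + a) + a ^+ 2 * (b ^+ 2 * (m + 1 - D') + b).
  rewrite -eX; apply: le_trans leX _.
  by apply: lerD; rewrite ler_wpM2l ?sqr_ge0.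
rewrite -subr_ge0 => le0.
have ab_gt0 : 0 < 2 * (a ^+ 2 * b ^+ 2) by rewrite !mulr_gt0 ?exprn_gt0.
rewrite -subr_ge0 -(pmulr_rge0 _ ab_gt0); apply: le_trans le0 _.
rewrite le_eqVlt; apply/orP; left; apply/eqP; field.
by rewrite a0 b0.
Qed.
End AverageCut.

(** * A quadratic potential *)

Section Potential.
Variables (R : realFieldType).
Implicit Types (w a : R).

(* The drift of the walk of unused half-edges is absorbed by the quadratic
   term, which is inactive beyond [w]. *)
Definition potential w a := a / 2 + Num.max 0 (w - a) ^+ 2 / w.

Lemma potential0 w : 0 < w -> potential w 0 = w.
Proof.
by move=> w_gt0; rewrite /potential mul0r add0r subr0 max_r ?ltW // expr2 mulfK ?gt_eqF.
Qed.

Lemma potential_ge w a : 0 < w -> a / 2 <= potential w a.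
Proof. by move=> w_gt0; rewrite lerDl divr_ge0 ?sqr_ge0 // ltW. Qed.

(** The linear parts cancel, and the second difference of the squared positive part is at most 2. *)
Lemma potential_mid w a : 0 < w ->
  potential w (a - 1) + potential w (a + 1) <= 2 * potential w a + 2 / w.
Proof.
move=> w_gt0; rewrite -subr_ge0 -(pmulr_rge0 _ w_gt0) /potential.
set z := Num.max 0 (w - a); set u := Num.max 0 (w - (a - 1)).
set v := Num.max 0 (w - (a + 1)).
have -> : w * (2 * (a / 2 + z ^+ 2 / w) + 2 / w -
  ((a - 1) / 2 + u ^+ 2 / w + ((a + 1) / 2 + v ^+ 2 / w)))
   = 2 * z ^+ 2 + 2 - u ^+ 2 - v ^+ 2 by field; rewrite gt_eqF.
rewrite /u /v /z /Num.max; case: ltP => ?; case: ltP => ?; case: ltP => ?; nra.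
Qed.

Lemma potential_incr w a : 2 <= w -> potential w (a + 1) <= potential w a + 1 / 2.
Proof.
move=> w_ge2; have w_gt0 : 0 < w by apply: lt_le_trans w_ge2.
rewrite /potential mulrDl -addrA [leRHS]addrAC -addrA lerD2l lerD2l.
rewrite ler_pM2r ?invr_gt0 // /Num.max; case: ltP => ?; case: ltP => ?; nra.
Qed.

(** Here the quadratic term loses (2 * (w - a) - 1) / w >= 1 - 1 / w, against a gain of 1 / 2 in the
    linear one. *)
Lemma potential_decr w a : 2 <= w -> a <= w / 2 -> potential w (a + 1) <= potential w a - 1 / 2 + w^-1.
Proof.
move=> w_ge2 le_a; have w_gt0 : 0 < w by apply: lt_le_trans w_ge2.
 have ge1 : 0 <= w - (a + 1) by lra.
have ge0 : 0 <= w - a by lra.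
rewrite -subr_ge0 -(pmulr_rge0 _ w_gt0) /potential.
set u := Num.max 0 (w - a); set v := Num.max 0 (w - (a + 1)).
have -> : w * (a / 2 + u ^+ 2 / w - 1 / 2 + w^-1 - ((a + 1) / 2 + v ^+ 2 / w))
   = u ^+ 2 - v ^+ 2 - w + 1 by field; rewrite gt_eqF.
have -> : v = w - (a + 1) by apply: max_r.
have -> : u = w - a by apply: max_r.
by nra.
Qed.

End Potential.

(** * Replacing cross pairs one at a time *)

Section Interpolation.
Variables (R : realFieldType) (I H : finType).
Variables (ok : pred I) (chi : I -> H -> bool) (ty : pred H).
Hypothesis ok_ex : exists i, ok i.
Hypothesis even_ty : forall b, ~~ odd #|unused ty b [::]|.
Implicit Types (x y : H) (p : H * H) (P Q T : seq (H * H)).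

Local Notation avgcut := (avgcut R ok chi ty).
Local Notation unused := (unused ty).

Definition pure p := ty p.1 == ty p.2.

Lemma card_unused_cons b p P : uniq (endpoints (p :: P)) ->
  #|unused b P| = (#|unused b (p :: P)| + (ty p.1 == b) + (ty p.2 == b))%N.
Proof.
case: p => x y; rewrite /endpoints /= -/(endpoints P) inE negb_or.
case/and3P=> /andP[nxy nx] ny _.
rewrite (cardsD1 x) (cardsD1 y (_ :\ x)) !inE nx ny (eq_sym y) nxy !andbT /=.
rewrite addnA addnC addnA; do 2!congr addn.
by apply: eq_card => z; rewrite !inE !negb_or; case: (z == x); case: (z == y); rewrite ?andbF.
Qed.

Lemma even_unused b Q : uniq (endpoints Q) -> all pure Q -> ~~ odd #|unused b Q|.
Proof.
elim: Q => [|p Q IH] uQ; first by rewrite even_ty.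
case/andP=> /eqP pp pQ.
have uQ' : uniq (endpoints Q) by case/and3P: uQ.
have := IH uQ' pQ; rewrite (card_unused_cons b uQ) pp -addnA addnn oddD odd_double.
by rewrite addbF.
Qed.

Lemma map_ty_pure Q : all pure Q ->
  map ty (endpoints ([seq p <- Q | ty p.1] ++ [seq p <- Q | ~~ ty p.1]))
  = nseq (count ty (endpoints Q)) true ++ nseq (count (predC ty) (endpoints Q)) false.
Proof.
move=> pQ; rewrite endpoints_cat map_cat; congr (_ ++ _).
  elim: Q pQ => //= -[x y] Q IH /andP[/eqP /= e /IH {}IH].
  by case tx: (ty x); rewrite /endpoints /= -/(endpoints _) -e tx //= IH.
elim: Q pQ => //= -[x y] Q IH /andP[/eqP /= e /IH {}IH].
by case tx: (ty x); rewrite /endpoints /= -/(endpoints _) -e tx //= IH.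
Qed.

(** Once sorted by type, pure lists with the same endpoints have the same types along the list. *)
Lemma avgcut_pure P Q : uniq (endpoints P) -> perm_eq (endpoints P) (endpoints Q) ->
  all pure P -> all pure Q -> avgcut P = avgcut Q.
Proof.
move=> uP ePQ pP pQ.
pose srt P := [seq p <- P | ty p.1] ++ [seq p <- P | ~~ ty p.1].
have perm_srt P' : perm_eq (srt P') P'.
  by rewrite /srt (perm_filterC (fun p => ty p.1)).
rewrite -(avgcut_perm _ _ _ _ (perm_srt P)) -(avgcut_perm _ _ _ _ (perm_srt Q)).
have uQ : uniq (endpoints Q) by rewrite -(perm_uniq ePQ).
apply: avgcut_endpoints.
- by rewrite (perm_uniq (perm_endpoints (perm_srt P))).
- by rewrite (perm_uniq (perm_endpoints (perm_srt Q))).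
- by rewrite !map_ty_pure // !(seq.permP ePQ).
Qed.

Lemma avgcut_fill T Q : perm_eq (endpoints T) (enum H) -> all pure T ->
  uniq (endpoints Q) -> all pure Q ->
  avgcut T <= avgcut Q + #|unused true Q|%:R / 2 + #|unused false Q|%:R / 2.
Proof.
move=> fT pT.
have [m] := ubnP (#|unused true Q| + #|unused false Q|).
elim: m Q => // m IH Q ltm uQ pQ.
have [[b [x Ux]]|none] : (exists b, exists x, x \in unused b Q)
    \/ (forall b, unused b Q = set0).
  have [E1|/set0Pn[x ?]] := eqVneq (unused true Q) set0; last by left; exists true, x.
  have [E2|/set0Pn[x ?]] := eqVneq (unused false Q) set0; last by left; exists false, x.
  by right; case.
  (* Parity provides a partner for [x] within its type. *)
  have := even_unused b uQ pQ; rewrite (cardsD1 x) Ux.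
  case: (set_0Vmem (unused b Q :\ x)) => [->|[y]]; first by rewrite cards0.
  rewrite !inE => /and3P[nyx ty_y ny] _.
  move: Ux; rewrite inE => /andP[ty_x nx].
  have uQ' : uniq (endpoints ((x, y) :: Q)).
    by rewrite /endpoints /= -/(endpoints Q) inE negb_or eq_sym nyx nx ny.
  have pQ' : all pure ((x, y) :: Q).
    by rewrite /= pQ /pure /= (eqP ty_x) (eqP ty_y) eqxx.
  have cE c := card_unused_cons c uQ'; rewrite /= (eqP ty_x) (eqP ty_y) in cE.
  have := IH ((x, y) :: Q) _ uQ' pQ'; rewrite !cE in ltm *.
  move=> /(_ _)/le_trans; apply; first by case: b ltm {cE ty_x ty_y} => /=; lia.
  have := avgcut_cons_le R chi ty ok_ex (x, y) Q.
  by case: b {cE ltm ty_x ty_y} => /=; rewrite !natrD /=; lra.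
rewrite !none !cards0 mul0r !addr0; suff -> : avgcut T = avgcut Q by []; apply: avgcut_pure => //.
  by rewrite (perm_uniq fT) enum_uniq.
apply: (perm_trans fT); apply: uniq_perm; rewrite ?enum_uniq // => x.
rewrite mem_enum inE; apply/esym.
by have /setP/(_ x) := none (ty x); rewrite !inE eqxx => /negbFE.
Qed.

(** Induction on the cross pairs [C], with [Q] arbitrary since it absorbs the replacements. Each
    cross pair costs at most 4 / w in cut and potential together. *)
Lemma avgcut_interpolate (w : R) T C Q : 2 <= w ->
  perm_eq (endpoints T) (enum H) -> all pure T ->
  uniq (endpoints (C ++ Q)) -> all (predC pure) C -> all pure Q ->
  avgcut T <= avgcut (C ++ Q) + potential w #|unused true (C ++ Q)|%:R
    + potential w #|unused false (C ++ Q)|%:R + 4 / w * (size C)%:R.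
Proof.
move=> w2 fT pT.
have w_gt0 : 0 < w by apply: lt_le_trans w2.
elim: C Q => [|e C IH] Q uP.
  move=> _ pQ; rewrite mulr0 addr0; apply: le_trans (avgcut_fill fT pT uP pQ) _.
  by rewrite -[leLHS]addrA -[leRHS]addrA lerD2l lerD ?potential_ge.
case/andP=> ce cC pQ.
(* [avgcut] ignores the orientation of a pair, so the [true] end may come first. *)
wlog [tx ty_y] : e uP ce / ty e.1 /\ ty e.2 = false.
  case: e uP ce => x y uP ce wl; case tx: (ty x).
    have ty_y : ty y = false by move: ce; rewrite /= /pure /= tx; case: (ty y).
    exact: (wl (x, y) uP ce (conj tx ty_y)).
  have ty_y : ty y by move: ce; rewrite /= /pure /= tx; case: (ty y).
  have uP' : uniq (endpoints ((y, x) :: C ++ Q)).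
    move: uP; rewrite /endpoints /= -/(endpoints _) !inE !negb_or.
    by rewrite eq_sym => /and3P[/andP[-> ->] -> ->].
  have := wl (y, x) uP'; rewrite /= !(avgcut_swap R ok chi ty y x).
  have unE b : unused b ((y, x) :: C ++ Q) = unused b ((x, y) :: C ++ Q).
    by apply/setP => z; rewrite !inE orbCA.
  by rewrite !unE; apply; rewrite /pure /= ?tx ?ty_y.
case: e uP ce tx ty_y => x y uP _ /= tx ty_y.
set P := C ++ Q in IH *; rewrite /= -/P.
have uP0 : uniq (endpoints P) by case/and3P: uP.
have /= cE c := card_unused_cons c uP; rewrite tx ty_y -/P in cE.
set a := #|unused true ((x, y) :: P)|%:R; set b := #|unused false ((x, y) :: P)|%:R.
have caE : #|unused true P|%:R = a + 1 :> R by rewrite cE /= addn0 natrD.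
have cbE : #|unused false P|%:R = b + 1 :> R by rewrite cE /= addn0 natrD.
have lew : 0 < w^-1 by rewrite invr_gt0.
have sE : 4 / w * (size C).+1%:R = 4 / w * (size C)%:R + 4 * w^-1 :> R.
  by rewrite -(natr1 (size C)) mulrDr mulr1.
rewrite sE.
have := IH Q uP0 cC pQ; rewrite -/P caE cbE => IHdel.
have ge_del := avgcut_cons_ge R chi ty ok_ex (x, y) P.
have ia := potential_incr a w2; have ib := potential_incr b w2.
have [le_a|lt_a] := leP a (w / 2).
  by have := potential_decr w2 le_a; lra.
have [le_b|lt_b] := leP b (w / 2).
  by have := potential_decr w2 le_b; lra.
have other c z : z \in unused c P -> (1 : R) < #|unused c P|%:R ->
    exists2 z', z' \in unused c P & z != z'.
  move=> Uz; rewrite ltr1n (cardsD1 z) Uz ltnS => /card_gt0P[z'].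
  by rewrite in_setD1 => /andP[nz Uz']; exists z'; rewrite // eq_sym.
have [/= nxy nx ny] : [/\ x != y, x \notin endpoints P & y \notin endpoints P].
  by move: uP; rewrite /endpoints /= inE negb_or => /andP[/andP[-> ->] /andP[-> _]].
have Ux : x \in unused true P by rewrite inE tx nx.
have Uy : y \in unused false P by rewrite inE ty_y ny.
have [x' Ux' nx'] : exists2 x', x' \in unused true P & x != x'.
  by apply: other Ux _; rewrite caE; lra.
have [y' Uy' ny'] : exists2 y', y' \in unused false P & y != y'.
  by apply: other Uy _; rewrite cbE; lra.
have := avgcut_cross R chi ok_ex uP0 Ux Ux' nx' Uy Uy' ny'.
have step c z z' : z \in unused c P -> z' \in unused c P -> z != z' ->
    avgcut T <= avgcut ((z, z') :: P)
      + potential w #|unused true ((z, z') :: P)|%:R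
      + potential w #|unused false ((z, z') :: P)|%:R + 4 / w * (size C)%:R
    /\ forall c', #|unused c' P| = (#|unused c' ((z, z') :: P)| + 2 * (c == c'))%N.
  rewrite !inE => /andP[/eqP tz nz] /andP[/eqP tz' nz'] nzz'.
  have uz : uniq (endpoints ((z, z') :: P)).
    by rewrite /endpoints /= inE negb_or nzz' nz nz'.
  split; last first.
    by move=> c'; rewrite (card_unused_cons c' uz) /= tz tz' -addnA addnn mul2n.
  have permP : perm_eq (C ++ (z, z') :: Q) ((z, z') :: P).
    by rewrite perm_catC /= perm_cons perm_catC.
  have := IH ((z, z') :: Q); rewrite (perm_uniq (perm_endpoints permP)) => /(_ uz cC).
  rewrite /= pQ /pure /= tz tz' eqxx => /(_ isT).
  rewrite (avgcut_perm _ _ _ _ permP).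
  have unE c' : unused c' (C ++ (z, z') :: Q) = unused c' ((z, z') :: P).
    by apply/setP => h; rewrite !inE (perm_mem (perm_endpoints permP)).
  by rewrite !unE.
have [sx cx] := step _ _ _ Ux Ux' nx'; have [sy cy] := step _ _ _ Uy Uy' ny'.
have cxt : #|unused true ((x, x') :: P)|%:R = a - 1 :> R.
  by have /(congr1 (fun m => m%:R : R)) := cx true; rewrite muln1 natrD caE; lra.
have cxf : #|unused false ((x, x') :: P)|%:R = b + 1 :> R.
  by rewrite -cbE cx muln0 addn0.
have cyt : #|unused true ((y, y') :: P)|%:R = a + 1 :> R.
  by rewrite -caE cy muln0 addn0.
have cyf : #|unused false ((y, y') :: P)|%:R = b - 1 :> R.
  by have /(congr1 (fun m => m%:R : R)) := cy false; rewrite muln1 natrD cbE; lra.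
rewrite cxt cxf in sx; rewrite cyt cyf in sy.
rewrite caE cbE.
(* Averaged over the two replacements, each potential costs at most 1 / w. The error of
   [avgcut_cross], with 1 / (a + 1) and 1 / (b + 1) at most 2 / w, adds 2 / w: together 4 / w. *)
have ma := potential_mid a w_gt0; have mb := potential_mid b w_gt0.
have inv_le c : w / 2 < c -> (c + 1)^-1 <= 2 * w^-1.
  move=> ltc; rewrite -[2]invrK -invfM lef_pV2 ?posrE; lra.
have ja := inv_le _ lt_a; have jb := inv_le _ lt_b.
by lra.
Qed.
End Interpolation.

(** * Perfect matchings as lists of pairs *)

Section Matchings.
Variable H : finType.
Implicit Types (x y : H) (p q : H * H) (P Q : seq (H * H)) (B : {set H}).
Implicit Types (M : perfect_matching H) (g : {perm H}).

Definition blocks P : {set {set H}} := [set B in [seq [set p.1; p.2] | p <- P]].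

(** The list fixes an order of the blocks and an orientation of each, so a matching may have many
    representing lists. *)
Definition represents M P := perm_eq (endpoints P) (enum H) /\ val M = blocks P.

Lemma mem_endpoints P x : (x \in endpoints P) = has (fun p => x \in [set p.1; p.2]) P.
Proof.
elim: P => //= p P IH.
by rewrite /endpoints /= -/(endpoints P) !inE IH orbA.
Qed.

Lemma endpoints_uniq_eq P p q x : uniq (endpoints P) -> p \in P -> q \in P ->
  x \in [set p.1; p.2] -> x \in [set q.1; q.2] -> p = q.
Proof.
elim: P => // r P IH; rewrite /endpoints /= -/(endpoints P) inE negb_or.
case/and3P=> /andP[_ n1] n2 uP.
have notin s : s \in P -> x \in [set s.1; s.2] -> x \notin [set r.1; r.2].
  move=> Ps xs; have xP : x \in endpoints P by rewrite mem_endpoints; apply/hasP; exists s.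
  by rewrite !inE; apply/negP => /orP[] /eqP e; rewrite e ?(negbTE n1) ?(negbTE n2) in xP.
rewrite inE => /predU1P[-> | Pp]; rewrite inE => /predU1P[-> | Pq] // xp xq.
- by rewrite (negbTE (notin _ Pq xq)) in xp.
- by rewrite (negbTE (notin _ Pp xp)) in xq.
- exact: IH.
Qed.

Lemma card_pair P p : uniq (endpoints P) -> p \in P -> #|[set p.1; p.2]| = 2.
Proof.
elim: P => // r P IH; rewrite /endpoints /= -/(endpoints P) inE negb_or.
case/and3P=> /andP[n _] _ uP; rewrite inE => /predU1P[->|]; last exact: IH.
by rewrite cards2 n.
Qed.

Lemma uniq_pairs P : uniq (endpoints P) -> uniq [seq [set p.1; p.2] | p <- P].
Proof.
move=> uP; rewrite map_inj_in_uniq.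
  elim: P uP => // p P IH; rewrite /endpoints /= -/(endpoints P) inE negb_or.
  case/and3P=> /andP[_ n] _ /IH ->; rewrite andbT.
  apply: contra n => Pp; rewrite mem_endpoints; apply/hasP; exists p => //.
  by rewrite !inE eqxx.
move=> p q Pp Pq epq; apply: (endpoints_uniq_eq (x := p.1) uP) => //.
  by rewrite !inE eqxx.
by rewrite -epq !inE eqxx.
Qed.

Lemma blocks_matching P : perm_eq (endpoints P) (enum H) ->
  is_perfect_matching (blocks P).
Proof.
move=> eP; have uP : uniq (endpoints P) by rewrite (perm_uniq eP) enum_uniq.
have blocksP B : reflect (exists2 p, p \in P & B = [set p.1; p.2]) (B \in blocks P).
  by rewrite inE; apply: mapP.
apply/andP; split; last first.
  by apply/forall_inP => B /blocksP[p Pp ->]; rewrite (card_pair uP).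
apply/and3P; split.
- rewrite eqEsubset subsetT /=; apply/subsetP => x _.
  have : x \in endpoints P by rewrite (perm_mem eP) mem_enum.
  rewrite mem_endpoints => /hasP[p Pp xp]; apply/bigcupP; exists [set p.1; p.2] => //.
  by apply/blocksP; exists p.
- apply/trivIsetP => _ _ /blocksP[p Pp ->] /blocksP[q Pq ->].
  apply: contraR => /pred0Pn[x /andP[xp xq]].
  by rewrite (endpoints_uniq_eq uP Pp Pq xp xq).
- by apply/negP => /blocksP[p Pp /setP/(_ p.1)]; rewrite !inE eqxx.
Qed.

Definition block_pair B : option (H * H) :=
  if enum B is [:: x; y] then Some (x, y) else None.

Definition pairs_of M : seq (H * H) := pmap block_pair (enum (val M)).

Lemma block_pairP B : #|B| = 2 ->
  exists2 p, block_pair B = Some p & enum B = [:: p.1; p.2].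
Proof.
rewrite /block_pair cardE; case: (enum B) => [|x [|y [|]]] // _.
by exists (x, y).
Qed.

Lemma pairs_of_represents M : represents M (pairs_of M).
Proof.
have /andP[partM /forall_inP cardM] := valP M.
have endsE (s : seq {set H}) : {in s, forall B, #|B| = 2} ->
    endpoints (pmap block_pair s) = flatten [seq enum B | B <- s].
  elim: s => //= B s IH cards; have [p -> ->] := block_pairP (cards B (mem_head _ _)).
  rewrite /= /endpoints /= -/(endpoints _) IH // => C sC.
  by apply: cards; rewrite inE sC orbT.
have cards B : B \in enum (val M) -> #|B| = 2 by rewrite mem_enum => /cardM/eqP.
split.
  rewrite endsE //.
  have memE : enum H =i flatten [seq enum B | B <- enum (val M)].
    move=> x; rewrite mem_enum; apply/esym/flatten_mapP.
    have : x \in cover (val M) by rewrite (cover_partition partM) inE.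
    by case/bigcupP=> B MB xB; exists B; rewrite mem_enum.
  rewrite perm_sym; apply: uniq_perm; rewrite ?enum_uniq //.
  rewrite (uniq_size_uniq (enum_uniq H) memE) -cardT -cardsT.
  rewrite (card_partition partM) size_flatten /shape -map_comp sumnE big_map.
  by rewrite big_enum /=; apply/eqP/eq_bigr => B _; rewrite cardE.
apply/setP => B; rewrite inE; apply/idP/mapP.
  move=> MB; have [p Bp eB] := block_pairP (eqP (cardM B MB)); exists p.
    by rewrite mem_pmap -Bp map_f // mem_enum.
  by apply/setP => x; rewrite -mem_enum eB !inE.
case=> p; rewrite mem_pmap => /mapP[C]; rewrite mem_enum => MC ep ->.
have [q Cq eC] := block_pairP (eqP (cardM C MC)).
move: ep; rewrite Cq => -[->]; suff -> : [set q.1; q.2] = C by [].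
by apply/setP => x; rewrite -[RHS]mem_enum eC !inE.
Qed.

Lemma imset_blocks g P : [set g @: (B : {set H}) | B in blocks P] = blocks (map_pairs g P).
Proof.
have imE p : g @: [set p.1; p.2] = [set g p.1; g p.2].
  by rewrite imsetU1 imset_set1.
apply/setP => B; rewrite inE /map_pairs -map_comp; apply/imsetP/mapP.
  case=> C; rewrite inE => /mapP[p Pp ->] ->; exists p => //=.
case=> p Pp ->; exists [set p.1; p.2] => /=; last by rewrite imE.
by rewrite inE; apply/mapP; exists p.
Qed.

Lemma perm_endpoints_map g P : perm_eq (endpoints P) (enum H) ->
  perm_eq (endpoints (map_pairs g P)) (enum H).
Proof.
rewrite endpoints_map => eP; apply: uniq_perm; rewrite ?enum_uniq //.
  by rewrite map_inj_uniq ?(perm_uniq eP) ?enum_uniq //; apply: perm_inj.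
move=> x; rewrite mem_enum -[x](permKV g) mem_map ?(perm_mem eP) ?mem_enum //.
exact: perm_inj.
Qed.

(** [insubd] never falls back on [M], because the image of a perfect matching is again one, as
    [val_act_matching] confirms. *)
Definition act_matching g M : perfect_matching H :=
  insubd M [set g @: (B : {set H}) | B in val M].

Lemma val_act_matching g M :
  val (act_matching g M) = [set g @: (B : {set H}) | B in val M].
Proof.
apply: insubdK; have [eP ->] := pairs_of_represents M; rewrite imset_blocks.
by apply: blocks_matching; apply: perm_endpoints_map.
Qed.

Lemma represents_act g M P : represents M P ->
  represents (act_matching g M) (map_pairs g P).
Proof.
case=> eP eM; split; first exact: perm_endpoints_map.
by rewrite val_act_matching eM imset_blocks.
Qed.

Lemma act_matching_inj g : injective (act_matching g).
Proof.
move=> M N /(congr1 val); rewrite !val_act_matching => eMN; apply: val_inj.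
by apply: (imset_inj _ eMN); apply: imset_inj; apply: perm_inj.
Qed.

End Matchings.

(** * Cuts in the configuration model *)

Section ConfigurationModel.
Variables (N d : nat).
Implicit Types (M : perfect_matching (half_edge N d)) (S : {set 'I_N}).
Local Notation H := (half_edge N d).

Definition in_side S (h : H) := h.1 \in S.

Lemma cut_config M S P : represents M P ->
  cut (config_graph M) S = count (separates in_side S) P.
Proof.
case=> eP eM; have uP : uniq (endpoints P) by rewrite (perm_uniq eP) enum_uniq.
pose crossing (B : {set H}) :=
  (#|[set h.1 | h in B]| == 2) && (#|[set h.1 | h in B] :&: S| == 1).
have memM B : (B \in val M) = (B \in [seq [set p.1; p.2] | p <- P]).
  by rewrite eM inE.
transitivity (count crossing [seq [set p.1; p.2] | p <- P]).
  rewrite -size_filter; have /card_uniqP <- := filter_uniq crossing (uniq_pairs uP).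
  rewrite /cut /= -(card_imset _ (@val_inj _ _ (config_edge M))).
  apply: eq_card => B; rewrite mem_filter; apply/imsetP/andP.
    case=> e; rewrite inE => ce ->; split=> //.
    by rewrite -memM (valP e).
  by case=> cB; rewrite -memM => MB; exists (Sub B MB); rewrite ?inE /config_ends SubK.
rewrite count_map; apply: eq_in_count => p Pp /=.
rewrite /crossing imsetU1 imset_set1 /separates /in_side /=.
(* Equal vertices give a loop, which has a single end and is never separated. *)
move: p.1.1 p.2.1 => x y; rewrite cards2; have [->|nxy] := eqVneq x y.
  by rewrite eqxx.
rewrite setIUl cardsU.
have s1 z : #|[set z] :&: S| = (z \in S).
  case zS: (z \in S); first by rewrite (setIidPl _) ?sub1set ?cards1.
  by apply/eqP; rewrite cards_eq0 setI_eq0 disjoints1 zS.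
have -> : [set x] :&: S :&: ([set y] :&: S) = set0.
  by apply/setP => z; rewrite !inE; case: eqP => // ->; rewrite (negbTE nxy) andbF.
by rewrite !s1 cards0 subn0; case: (x \in S); case: (y \in S).
Qed.

Lemma maxcut_card_config k M P : represents M P ->
  maxcut_card k (config_graph M) = mcut (fun S => #|S| == k) in_side P.
Proof. by move=> rMP; apply: eq_bigr => S _; apply: cut_config. Qed.

(** [act_matching g] permutes the perfect matchings, so relabelling the half-edges keeps the uniform
    distribution. *)
Lemma sum_mcut_act (R : realFieldType) k (g : {perm H}) :
  \sum_(M : perfect_matching H) (mcut (fun S => #|S| == k) in_side (map_pairs g (pairs_of M)))%:R
    = \sum_(M : perfect_matching H) (maxcut_card k (config_graph M))%:R :> R.
Proof.
rewrite [RHS](reindex_inj (@act_matching_inj _ g)) /=; apply: eq_bigr => M _.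
rewrite (maxcut_card_config k (represents_act g (pairs_of_represents M))) //.
Qed.

End ConfigurationModel.

(** The induced self-map of [H1] is injective, hence a permutation. This splits a permutation that
    preserves the halves into one on each copy. *)
Lemma perm_restrict (H1 H2 : finType) (f : H1 -> H2) (g : {perm H2}) :
  injective f -> (forall x, exists y, g (f x) = f y) ->
  exists s : {perm H1}, forall x, g (f x) = f (s x).
Proof.
move=> f_inj gf; pose s x := odflt x [pick y | g (f x) == f y].
have sE x : g (f x) = f (s x).
  rewrite /s; case: pickP => [y /eqP //|no].
  by have [y e] := gf x; have := no y; rewrite e eqxx.
have s_inj : injective s.
  by move=> x y exy; apply/f_inj/(@perm_inj _ g); rewrite !sE exy.
by exists (perm s_inj) => x; rewrite permE.
Qed.

(** * Two copies of the model side by side *)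

Section TwoCopies.
Variables (n d : nat).
Local Notation H1 := (half_edge n d).
Local Notation H2 := (half_edge (n + n) d).
Implicit Types (b : bool) (P Q : seq (H1 * H1)).

Definition copy b (h : H1) : H2 := (if b then lshift n h.1 else rshift n h.1, h.2).

Definition in_first (h : H2) := (h.1 < n)%N.

Lemma copy_inj b : injective (copy b).
Proof.
move=> [v i] [w j] [e ->]; congr pair; move: e; case: b.
  exact: lshift_inj.
exact: rshift_inj.
Qed.

Lemma in_first_copy b h : in_first (copy b h) = b.
Proof.
by case: b; rewrite /in_first /= ?ltn_ord //; apply/negbTE; rewrite -leqNgt leq_addr.
Qed.

Lemma in_firstP b h : in_first h = b -> exists h', h = copy b h'.
Proof.
case: h => v i; rewrite /in_first /=; case: (splitP v) => w ev.
  have -> : v = lshift n w by apply: val_inj.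
  by move=> <-; exists (w, i).
have -> : v = rshift n w by apply: val_inj.
by move=> <-; exists (w, i).
Qed.

Lemma card_unused_nil b : #|unused in_first b [::]| = (n * d)%N.
Proof.
rewrite -[RHS](_ : #|{: H1}| = _); last by rewrite card_prod !card_ord.
rewrite -(card_imset _ (@copy_inj b)); apply: eq_card => h; rewrite !inE andbT.
apply/eqP/imsetP => [/in_firstP[h' ->]|[h' _ ->]]; last exact: in_first_copy.
by exists h'.
Qed.

Definition juxtapose P Q : seq (H2 * H2) :=
  map_pairs (copy true) P ++ map_pairs (copy false) Q.

Lemma pure_juxtapose P Q : all (pure in_first) (juxtapose P Q).
Proof.
by rewrite all_cat !all_map; apply/andP; split; apply/allP => p _ /=;
  rewrite /pure !in_first_copy.
Qed.

Lemma perm_endpoints_juxtapose P Q :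
  perm_eq (endpoints P) (enum H1) -> perm_eq (endpoints Q) (enum H1) ->
  perm_eq (endpoints (juxtapose P Q)) (enum H2).
Proof.
move=> eP eQ; rewrite endpoints_cat !endpoints_map.
apply: uniq_perm; [|exact: enum_uniq|move=> h].
  rewrite cat_uniq !map_inj_uniq ?(perm_uniq eP) ?(perm_uniq eQ) ?enum_uniq;
    try exact: copy_inj.
  rewrite andbT /=; apply/hasPn => _ /mapP[h _ ->]; apply/negP => /mapP[h' _].
  by move/(congr1 in_first); rewrite !in_first_copy.
rewrite mem_enum mem_cat; case e: (in_first h); have [h' ->] := in_firstP e.
  by rewrite mem_map ?(perm_mem eP) ?mem_enum //; apply: copy_inj.
by rewrite orbC mem_map ?(perm_mem eQ) ?mem_enum //; apply: copy_inj.
Qed.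

Lemma map_pairs_juxtapose (g : {perm H2}) : g \in type_perms in_first ->
  exists s t : {perm H1}, forall P Q,
    map_pairs g (juxtapose P Q) = juxtapose (map_pairs s P) (map_pairs t Q).
Proof.
move=> /type_permsP gP.
have ex b : exists s : {perm H1}, forall x, g (copy b x) = copy b (s x).
  apply: (perm_restrict (@copy_inj b)) => x; apply: in_firstP.
  by rewrite gP in_first_copy.
have [s sE] := ex true; have [t tE] := ex false; exists s, t => P Q.
rewrite /juxtapose /map_pairs map_cat -!map_comp.
by congr cat; apply: eq_map => p; rewrite /= ?sE ?tE.
Qed.

Local Notation mcut1 k := (mcut (fun S : {set 'I_n} => #|S| == k) (@in_side n d)).
Local Notation mcut2 :=
  (mcut (fun S : {set 'I_(n + n)} => #|S| == n) (@in_side (n + n) d)).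

(* A [k]-subset in the first copy and the complement of a [k]-subset in the
   second one form a bisection. *)
Lemma mcut_juxtapose k P Q : (k <= n)%N ->
  (mcut1 k P + mcut1 k Q <= mcut2 (juxtapose P Q))%N.
Proof.
move=> kn.
have opt P' : exists2 S : {set 'I_n}, #|S| = k & mcut1 k P' = count (separates (@in_side n d) S) P'.
  (* [k <= n] makes the family of [k]-subsets nonempty, so the maximum is attained. *)
  have : (0 < #|[pred S : {set 'I_n} | #|S| == k]|)%N.
    by rewrite -cardsE card_draws card_ord bin_gt0.
  move/(bigop.eq_bigmax_cond (fun S => count (separates (@in_side n d) S) P')) => [S].
  by rewrite inE => /eqP cS e; exists S.
have [S cS ->] := opt P; have [T cT ->] := opt Q.
pose U := (@lshift n n) @: S :|: (@rshift n n) @: (~: T).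
have inU b h : (in_side U (copy b h)) = if b then h.1 \in S else h.1 \notin T.
  rewrite /in_side /copy; rewrite in_setU; case: b => /=.
    rewrite mem_imset; last exact: lshift_inj.
    rewrite orbC.
    suff /negbTE -> : lshift n h.1 \notin (@rshift n n) @: (~: T) by [].
    by apply/imsetP => -[v _ /eqP]; rewrite eq_lrshift.
  rewrite [X in _ || X]mem_imset ?in_setC; last exact: rshift_inj.
  suff /negbTE -> : rshift n h.1 \notin (@lshift n n) @: S by [].
  by apply/imsetP => -[v _ /eqP]; rewrite eq_rlshift.
have cU : #|U| == n.
  rewrite cardsU (_ : _ :&: _ = set0) ?cards0 ?subn0.
    rewrite !card_imset; [|exact: rshift_inj|exact: lshift_inj].
    by rewrite cS -cT cardsC card_ord.
  apply/setP => v; rewrite in_setI in_set0; apply/negbTE/negP => /andP[/imsetP[x _ ->] /imsetP[y _ /eqP]].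
  by rewrite eq_lrshift.
apply: leq_trans (mcut_geP _ _ cU); rewrite count_cat !count_map.
apply: leq_add; rewrite leq_eqVlt; apply/orP; left; apply/eqP; apply: eq_count => p /=.
  by rewrite /separates !inU.
(* Passing to the complement keeps the separated pairs. *)
by rewrite /separates !inU /in_side; case: (_ \in T); case: (_ \in T).
Qed.

Lemma bisection_ex : exists S : {set 'I_(n + n)}, #|S| == n.
Proof.
exists ((@lshift n n) @: setT); rewrite card_imset; last exact: lshift_inj.
by rewrite cardsT card_ord.
Qed.

Lemma maxbis_config (M : perfect_matching H2) :
  maxbis (config_graph M) = maxcut_card n (config_graph M).
Proof. have half : #|'I_(n + n)|./2 = n by rewrite card_ord addnn doubleK.
by apply: eq_bigl => S; rewrite half. Qed.

Section Expectation.
Variable R : realType.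

Local Notation avgcut2 := (avgcut R (fun S : {set 'I_(n + n)} => #|S| == n)
  (@in_side (n + n) d) in_first).

(** By [avgcut_pure] all juxtapositions have the same average, so it may be averaged over a matching
    [M] placed on both sides. For a fixed permutation the two sides carry relabelled copies of [M],
    and by linearity each contributes the expectation. *)
Lemma avgcut_juxtapose_ge k (M0 : perfect_matching H1) : (k <= n)%N ->
  2 * config_expect d (fun G : multigraph 'I_n => (maxcut_card k G)%:R : R)
  <= avgcut2 (juxtapose (pairs_of M0) (pairs_of M0)).
Proof.
move=> kn; rewrite /config_expect.
set m : R := #|_|%:R.
have m_gt0 : 0 < m by rewrite ltr0n; apply/card_gt0P; exists M0.
pose T (M : perfect_matching H1) := juxtapose (pairs_of M) (pairs_of M).
have fullT M : perm_eq (endpoints (T M)) (enum H2).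
  by have [eM _] := pairs_of_represents M; apply: perm_endpoints_juxtapose.
have eT M : avgcut2 (T M) = avgcut2 (T M0).
  apply: avgcut_pure; rewrite ?pure_juxtapose //.
    by rewrite (perm_uniq (fullT M)) enum_uniq.
  by apply: (perm_trans (fullT M)); rewrite perm_sym.
rewrite mulrA ler_pdivrMr // -/(T M0).
have -> : avgcut2 (T M0) * m = \sum_M avgcut2 (T M).
  by rewrite (eq_bigr _ (fun M _ => eT M)) sumr_const -mulr_natr.
rewrite /avgcut -mulr_suml exchange_big /= ler_pdivlMr ?card_type_perms_gt0 //.
rewrite mulr_natr -sumr_const; apply: ler_sum => g Gg.
have [s [t stE]] := map_pairs_juxtapose Gg.
rewrite mulr2n mulrDl mul1r -{1}(sum_mcut_act R k s) -(sum_mcut_act R k t) -big_split /=.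
by apply: ler_sum => M _; rewrite -natrD ler_nat stE; apply: mcut_juxtapose.
Qed.

End Expectation.
End TwoCopies.

(** * From pure to uniform matchings, and the final estimate *)

Lemma sum_avgcut (R : realFieldType) (N d k : nat) (ty : pred (half_edge N d)) :
  \sum_(M : perfect_matching (half_edge N d))
     avgcut R (fun S : {set 'I_N} => #|S| == k) (@in_side N d) ty (pairs_of M)
  = \sum_(M : perfect_matching (half_edge N d)) (maxcut_card k (config_graph M))%:R.
Proof.
rewrite /avgcut -mulr_suml exchange_big /=.
(* Each permutation preserves the uniform distribution, so all terms of the average are equal. *)
under eq_bigr => g _ do rewrite sum_mcut_act.
by rewrite sumr_const -[X in X / _]mulr_natr mulfK // gt_eqF ?card_type_perms_gt0.
Qed.

Local Notation avgbis R n d :=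
  (avgcut R (fun S : {set 'I_(n + n)} => #|S| == n) (@in_side (n + n) d) (@in_first n d)).

Lemma avgcut_full_le (R : rcfType) (n d : nat)
  (T : seq (half_edge (n + n) d * half_edge (n + n) d))
  (M : perfect_matching (half_edge (n + n) d)) :
  (0 < n)%N -> (0 < d)%N -> ~~ odd n ->
  perm_eq (endpoints T) (enum (half_edge (n + n) d : finType)) ->
  all (pure (@in_first n d)) T ->
  avgbis R n d T <= avgbis R n d (pairs_of M) + 4 * Num.sqrt (2 * (d * n)%:R).
Proof.
move=> n_gt0 d_gt0 n_even fT pT.
set avg := avgcut _ _ _ _; set w := Num.sqrt _.
(* A positive even [n] is at least 2; this yields [w >= 2]. *)
have m_ge2 : (2 <= (d * n)%:R :> R)%R.
  by rewrite ler_nat; move: d_gt0 n_gt0 n_even; case: (n) => [|[|n']] // *; nia.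
have w2E : w ^+ 2 = 2 * (d * n)%:R by rewrite sqr_sqrtr //; lra.
have w_ge0 : 0 <= w by apply: sqrtr_ge0.
have w_ge2 : 2 <= w by rewrite leNgt; apply/negP => ?; nra.
have w_gt0 : 0 < w by lra.
set P := pairs_of M; have [eP _] := pairs_of_represents M; rewrite -/P in eP.
pose C := [seq p <- P | predC (pure (@in_first n d)) p].
pose Q := [seq p <- P | pure (@in_first n d) p].
have perm_CQ : perm_eq (C ++ Q) P by rewrite perm_catC perm_filterC.
have memCQ h : h \in endpoints (C ++ Q).
  by rewrite (perm_mem (perm_endpoints perm_CQ)) (perm_mem eP) mem_enum.
have unused0 b : #|unused (@in_first n d) b (C ++ Q)| = 0%N.
  by apply/eqP; rewrite cards_eq0; apply/eqP/setP => h; rewrite !inE memCQ andbF.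
have even_ty b : ~~ odd #|unused (@in_first n d) b [::]|.
  by rewrite card_unused_nil oddM negb_and n_even.
have sizeC : (size C)%:R <= (d * n)%:R :> R.
  rewrite ler_nat; apply: (@leq_trans (size P)).
    by rewrite size_filter count_size.
  have := perm_size eP; rewrite size_endpoints -cardE card_prod !card_ord mulnDl (mulnC n d).
  by move: (size P) (d * n)%N => s m; lia.
have := avgcut_interpolate (@in_side (n + n) d) (bisection_ex n) even_ty w_ge2 fT pT.
move=> /(_ C Q); rewrite (perm_uniq (perm_endpoints perm_CQ)) (perm_uniq eP) enum_uniq.
rewrite !filter_all !unused0 potential0 // -/avg => /(_ isT isT isT) le1.
have <- : avg (C ++ Q) = avg P by apply: avgcut_perm.
apply: le_trans le1 _.
have : 4 / w * (size C)%:R <= 2 * w.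
  by rewrite mulrAC ler_pdivrMr // -mulrA -expr2 w2E; lra.
by lra.
Qed.

(** The inequality ln (1 + y) <= y at y = 1 / (1 + x) - 1, negated. *)
Lemma ln1Dx_ge (R : realType) (x : R) : 0 <= x -> x / (1 + x) <= ln (1 + x).
Proof.
move=> x0; have x1 : 0 < 1 + x by lra.
have -> : x / (1 + x) = - ((1 + x)^-1 - 1) by field; rewrite gt_eqF.
rewrite lerNl -lnV ?posrE //.
have := @le_ln1Dx R ((1 + x)^-1 - 1); rewrite addrCA subrr addr0; apply.
by rewrite ltrBrDl subrr invr_gt0.
Qed.

Theorem corollary4p2 (R : realType) (d n k : nat)
  (d_ge1 : (1 <= d)%N) (n_gt0 : (0 < n)%N) (n_even : ~~ odd n)
  (k_le_n : (k <= n)%N) :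
  2 * config_expect d (fun G : multigraph 'I_n => (maxcut_card k G)%:R : R)
  <= config_expect d (fun G : multigraph 'I_(2 * n) => (maxbis G)%:R : R)
     + 7 * Num.sqrt ((d * n)%:R * ln (1 + (d * n)%:R)).
Proof.
rewrite mul2n -addnn; set m : R := (d * n)%:R.
have m_ge2 : 2 <= m 
  by rewrite ler_nat; move: d_ge1 n_gt0 n_even; case: (n) => [|[|n']] // *; nia.
(* Without a perfect matching on [n] vertices the sum on the left is empty and the left side is
   0. *)
have [M0 _|no_matching] := pickP (perfect_matching (half_edge n d)); last first.
  rewrite /config_expect [X in 2 * (X / _)]big1 => [|M _]; last by have := no_matching M.
  rewrite mul0r mulr0 addr_ge0 ?mulr_ge0 ?sqrtr_ge0 ?invr_ge0 ?ler0n //.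
  by apply: sumr_ge0.
pose T := juxtapose (pairs_of M0) (pairs_of M0).
have [eM0 _] := pairs_of_represents M0.
have fT : perm_eq (endpoints T) (enum (half_edge (n + n) d : finType)).
  exact: perm_endpoints_juxtapose.
have pT := pure_juxtapose (pairs_of M0) (pairs_of M0).
apply: le_trans (avgcut_juxtapose_ge R M0 k_le_n) _; rewrite -/T.
set avg := avgcut _ _ _ _.
have le_expect : avg T <= config_expect d (fun G : multigraph 'I_(n + n) => (maxbis G)%:R : R)
    + 4 * Num.sqrt (2 * m).
  rewrite /config_expect; set c : R := #|_|%:R.
  (* [T] itself gives a perfect matching for 2n vertices. *)
  have c_gt0 : 0 < c.
    by rewrite ltr0n; apply/card_gt0P; exists (Sub (blocks T) (blocks_matching fT)).
  set err := 4 * _; rewrite -(ler_pM2r c_gt0) mulrDl divfK ?gt_eqF //.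
  rewrite (eq_bigr (fun M => (maxcut_card n (config_graph M))%:R)) => [|M _]; last first.
    by rewrite maxbis_config.
  (* Averaging over permutations inside the sum makes the comparison with [T] hold for every
     matching separately. *)
  rewrite -(sum_avgcut R n (@in_first n d)) !mulr_natr -!sumr_const -big_split /=.
  apply: ler_sum => M _. exact: avgcut_full_le.
apply: le_trans le_expect _; rewrite lerD2l.
(* For m >= 2 one has m / (1 + m) >= 2 / 3. After squaring, the constant 7 suffices because 4 ^ 2 *
   2 = 32 is below 49 * 2 / 3. *)
have ln_ge : 2 / 3 <= ln (1 + m).
  apply: le_trans (ln1Dx_ge (_ : 0 <= m)); last by lra.
  by rewrite ler_pdivlMr; lra.
rewrite -(@ler_pXn2r _ 2) ?nnegrE ?mulr_ge0 ?sqrtr_ge0 //.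
rewrite !exprMn !sqr_sqrtr; nra.
Qed.
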